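(* Consider the $2\times 2$ input-queued switch with symmetric arrivals and unit costs: $c_\rho=1$ for all $\rho\in\mathcal I$, the random variables $A_\rho(t)$, $\rho\in\mathcal I$, $t\in\mathbb{Z}_+$, are independent and identically distributed with mean $\lambda$, and $\lambda<1/2$. Then Algorithm 1 (described in the context) is optimal and minimizes the discounted infinite horizon cost: for every $\beta\in(0,1)$ and every initial state $q\in\mathbb{Z}_+^{\mathcal I}$, any policy $\pi$ that follows Algorithm 1 satisfies $$J_\beta(q,\pi)=\min_{\pi'\in\mathcal M}J_\beta(q,\pi').$$
   Context: Let $\mathcal I=\{(i,j): i,j\in\{1,2\}\}$ index the four queues of a $2\times 2$ input-queued switch (queue $(i,j)$ is for input port $i$ and output port $j$); $\mathbb{Z}_+=\{0,1,2,\dots\}$. A schedule is a vector $s=(s_\rho)_{\rho\in\mathcal I}\in\{0,1\}^{\mathcal I}$ with $\sum_j s_{(i,j)}\le 1$ for each $i$ and $\sum_i s_{(i,j)}\le 1$ for each $j$; $\mathcal P$ is the set of all schedules. In each time slot $t\in\mathbb{Z}_+$ a policy $\pi$ selects a schedule $S^\pi(t)\in\mathcal P$; $A_\rho(t)\in\mathbb{Z}_+$ is the number of arrivals to queue $\rho$ in slot $t$. Queue lengths evolve by $$Q^\pi_\rho(t+1)=[Q^\pi_\rho(t)-S^\pi_\rho(t)]^++A_\rho(t),\qquad Q^\pi(0)=q,$$ where $[x]^+=\max\{x,0\}$. $\mathcal M$ is the set of stationary Markov policies, i.e. those for which $S^\pi(t)$ depends only on $Q^\pi(t)$ (not on $t$).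 With cost $c^\pi(t)=\sum_{\rho\in\mathcal I}c_\rho Q^\pi_\rho(t)$, the discounted infinite horizon cost is $J_\beta(q,\pi)=\sum_{t=0}^\infty\mathbb{E}[\beta^t c^\pi(t)]$. Algorithm 1: the size of a schedule $s\in\mathcal P$ (in the current state) is the number of non-empty queues included in $s$. In every slot $t$ a schedule is chosen in the following order: (i) select a size-2 schedule, if one exists, with ties broken according to an arbitrary well-defined (possibly randomized) rule; (ii) otherwise, if there are two size-1 schedules serving different non-empty queues, then the longest queue among them is served; (iii) otherwise, the queue of the unique size-1 schedule is served (if all queues are empty there is nothing to serve). *)

(* Defs.v *)
From HB Require Import structures.
From mathcomp Require Import all_boot all_order all_algebra.
From mathcomp Require Import all_classical all_reals all_analysis.

Set Implicit Arguments.
Unset Strict Implicit.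
Unset Printing Implicit Defensive.

Import Order.TTheory GRing.Theory Num.Theory.

Local Open Scope classical_set_scope.
Local Open Scope ring_scope.

(* Queue (i, j) is for input port i and output port j. *)
Definition queue : finType := ('I_2 * 'I_2)%type.

Definition is_schedule (s : {ffun queue -> bool}) : bool :=
  [forall i : 'I_2, (\sum_(j < 2) s (i, j) <= 1)%N] &&
  [forall j : 'I_2, (\sum_(i < 2) s (i, j) <= 1)%N].

Definition schedule : finType := {s : {ffun queue -> bool} | is_schedule s}.

Definition serves (s : schedule) (r : queue) : bool := val s r.

Definition state := {ffun queue -> nat}.

(* Truncated subtraction on nat is the positive part [x - s]^+. *)
Definition next_state (x : state) (s : schedule) (a : state) : state :=
  [ffun r => (x r - serves s r + a r)%N].

Section Algorithm1.
Variable x : state.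

Definition served (s : schedule) : {set queue} :=
  [set r | serves s r && (0 < x r)%N].

Definition schedule_size (s : schedule) : nat := #|served s|.

(* The schedules that Algorithm 1 may choose in state x; several schedules are
   allowed exactly when there is a tie, or when they differ only in empty
   queues. *)
Definition algorithm1_choice (s : schedule) : bool :=
  if [exists s' : schedule, schedule_size s' == 2%N] then
    schedule_size s == 2%N
  else if [exists s1 : schedule, exists s2 : schedule,
             [&& schedule_size s1 == 1%N, schedule_size s2 == 1%N
               & served s1 != served s2]] then
    [exists r : queue, (served s == [set r]%SET) &&
      [forall s' : schedule, forall r' : queue,
         (served s' == [set r']%SET) ==> (x r' <= x r)%N]]
  else if [exists s' : schedule, schedule_size s' == 1%N] then
    schedule_size s == 1%N
  else true.

End Algorithm1.

Section Switch.
Context (d : measure_display) (T : measurableType d) (R : realType).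
Variable P : probability T R.

Definition mutually_independent (I : eqType) (X : I -> {RV P >-> nat}) : Prop :=
  forall (s : seq I) (B : I -> set nat), uniq s ->
    P (\bigcap_(i in [set` s]) (X i @^-1` B i)) =
    (\prod_(i <- s) fine (P (X i @^-1` B i)))%:E.

Definition identically_distributed (I : Type) (X : I -> {RV P >-> nat}) : Prop :=
  forall (i j : I) (B : set nat),
    distribution P (X i) B = distribution P (X j) B.

Variable A : queue -> nat -> {RV P >-> nat}.

Definition arrivals (t : nat) (w : T) : state := [ffun r => A r t w].

(* A policy is given by the schedules it selects, S t being the (random)
   schedule of slot t. *)
Fixpoint queue_length (q : state) (S : nat -> T -> schedule) (t : nat) (w : T)
    : state :=
  if t is u.+1
  then next_state (queue_length q S u w) (S u w) (arrivals u w)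
  else q.

(* The atoms of the history of arrivals and schedules before slot t. *)
Definition past (S : nat -> T -> schedule) (t : nat)
    (a : nat -> state) (s : nat -> schedule) : set T :=
  [set w | forall u, (u < t)%N -> arrivals u w = a u /\ S u w = s u].

(* S may be history dependent and randomized, but does not anticipate: the
   arrivals of slot t are independent of the earlier arrivals and of the
   schedules up to and including slot t.  All the variables are discrete, so
   atoms suffice; requiring this for every t makes the whole future of the
   arrivals independent of that history. *)
Definition is_policy (S : nat -> T -> schedule) : Prop :=
  (forall t (s : schedule), measurable [set w | S t w = s]) /\
  (forall t (a : nat -> state) (s : nat -> schedule),
     P (past S t a s `&` [set w | S t w = s t] `&` [set w | arrivals t w = a t])
     = (P (past S t a s `&` [set w | S t w = s t])
        * P [set w | arrivals t w = a t])%E).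

(* Given the past and the current queue lengths x, the schedule is drawn from a
   law kappa x that depends on x only, and not on t; point masses give the
   deterministic policies S t = f (Q t). *)
Definition stationary_markov (q : state) (S : nat -> T -> schedule) : Prop :=
  is_policy S /\
  exists kappa : state -> schedule -> R,
    [/\ forall x s, 0 <= kappa x s,
        forall x, \sum_(s : schedule) kappa x s = 1 &
        forall t (a : nat -> state) (s : nat -> schedule) (x : state)
               (s0 : schedule),
          P (past S t a s `&` [set w | queue_length q S t w = x]
               `&` [set w | S t w = s0])
          = ((kappa x s0)%:E *
             P (past S t a s `&` [set w | queue_length q S t w = x]))%E].

Definition follows_algorithm1 (q : state) (S : nat -> T -> schedule) : Prop :=
  is_policy S /\
  forall t, {ae P, forall w, algorithm1_choice (queue_length q S t w) (S t w)}.

Definition cost (c : queue -> R) (x : state) : R :=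
  \sum_(r : queue) c r * (x r)%:R.

Definition discounted_cost (c : queue -> R) (beta : R) (q : state)
    (S : nat -> T -> schedule) : \bar R :=
  (\sum_(0 <= t <oo)
     'E_P[fun w => (beta ^+ t * cost c (queue_length q S t w))%R])%E.

End Switch.

Definition is_minimum (R : realType) (E : set (\bar R)) (m : \bar R) : Prop :=
  E m /\ lbound E m.

(* Main.v *)
Require Import Defs.
From HB Require Import structures.
From mathcomp Require Import all_boot all_order all_algebra.
From mathcomp Require Import all_classical all_reals all_analysis.
From mathcomp Require Import measurable_realfun.
From mathcomp Require Import zify ring lra.
Import Order.TTheory GRing.Theory Num.Theory.

Set Implicit Arguments.
Unset Strict Implicit.
Unset Printing Implicit Defensive.

Local Open Scope classical_set_scope.
Local Open Scope ring_scope.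

(** Let [p], [p'] be the numbers of jobs at the two inputs and [o], [o'] the
    numbers of jobs bound for the two outputs.  The total number of jobs is a
    function of these four port loads.  Every schedule of size 2 takes one job
    from each port, and it exists as soon as no port is empty; if a port is
    empty, the non-empty queues share a port and one of them is served.  So the
    port loads evolve by themselves under Algorithm 1, which makes ties
    irrelevant, and the expected discounted cost of its first [n] slots is
    obtained from value iteration on functions of the loads: [serve] applies the
    decision of Algorithm 1, [average] adds the arrivals, [bellman] the current
    cost.

    That this is optimal is proved by propagating an invariant, [structured],
    along value iteration.  It consists of the symmetries of the switch
    (exchange of the inputs, of the outputs, and of inputs with outputs),
    monotonicity in every queue, supermodularity for conflicting queues,
    superconvexity for conflicting queues, and submodularity for compatible
    queues.  Superconvexity and symmetry imply [balanced]: among states that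
    differ by moving jobs from one output to the other, the more even one is
    cheaper, so that of two conflicting queues the longest should be served.
    Monotonicity gives the preference for size 2: the state reached after a
    schedule of size 1 has, up to the equivalence of states with equal loads,
    one more job.  Together these give [serve_le].  Averaging preserves the
    invariant because the inequalities are invariant under adding jobs and the
    arrivals are exchangeable; service preserves it by a case analysis on the
    empty ports.

    A policy does not anticipate: the history up to a slot, schedule included,
    is independent of the arrivals of that slot.  All the variables are
    discrete, so conditioning on the history amounts to summing over countably
    many atoms ([integral_indep]), and Bellman's inequality holds along the
    trajectory of any policy, with equality under Algorithm 1
    ([value_le_step], [value_eq_step]).  By induction the cost of the first [n]
    slots is at least [value n] for every policy and equal to it for Algorithm
    1; the discounted costs are the limits of these partial costs.  Finally the
    minimum is attained in the class of stationary Markov policies by a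
    deterministic choice among the schedules of Algorithm 1. *)

Notation q11 := ((ord0, ord0) : queue).
Notation q12 := ((ord0, ord_max) : queue).
Notation q21 := ((ord_max, ord0) : queue).
Notation q22 := ((ord_max, ord_max) : queue).

(** * Functions of the port loads *)

(** [p], [p'] are the numbers of jobs at the two inputs and [o], [o'] those
    bound for the two outputs.  If no port is empty there is a schedule of size
    2, and any of them takes one job from each port.  Otherwise all the jobs
    share a port, and the longest queue is the one at the busier input and the
    busier output.  The predecessors are truncated for the empty state. *)
Definition serve (V : Type) (W : nat -> nat -> nat -> nat -> V)
    (p p' o o' : nat) : V :=
  let e : nat := (0 < minn p p')%N && (0 < minn o o')%N in
  W (maxn p p').-1 (minn p p' - e)%N (maxn o o').-1 (minn o o' - e)%N.

Section Structure.
Context {R : realFieldType}.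
Implicit Type W : nat -> nat -> nat -> nat -> R.

(** Every job is counted at its input and at its output, whence the half: this
    form is symmetric in inputs and outputs even away from the quadruples with
    [p + p' = o + o']. *)
Definition bellman (beta : R) W (p p' o o' : nat) : R :=
  (p + p' + o + o')%:R / 2 + beta * serve W p p' o o'.

Record symmetric W : Prop := Symmetric {
  swap_inputs : forall p p' o o', W p' p o o' = W p p' o o';
  swap_outputs : forall p p' o o', W p p' o' o = W p p' o o';
  transpose : forall p p' o o', W o o' p p' = W p p' o o' }.

(** The invariant of value iteration.  Only quadruples with [p + p' = o + o']
    are port loads, so the inequalities are required there only.  One more job
    in queue (i, j) raises the loads of input i and output j.
    - [supermodular]: two jobs in queues that share a port cost more together
      than separately, as they cannot be served at the same time;
    - [superconvex]: a job in queue (1, 1) costs more if another job is bound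
      for output 1 than if that job is bound for output 2;
    - [submodular]: two jobs in compatible queues cost less together than
      separately.
    In these three the two sides have the same total number of jobs, and in
    [monotone11] the left one has fewer, so that adding the current cost
    preserves the inequalities; adding the same jobs to all the states preserves
    them too, hence so does averaging over arrivals. *)
Record structured W : Prop := Structured {
  structured_symmetric :> symmetric W;
  monotone11 : forall p p' o o', (p + p' = o + o')%N ->
    W p p' o o' <= W p.+1 p' o.+1 o';
  supermodular : forall p p' o o', (p + p' = o + o')%N ->
    W p.+1 p' o.+1 o' + W p p'.+1 o.+1 o'
      <= W p.+1 p'.+1 o.+2 o' + W p p' o o';
  superconvex : forall p p' o o', (p + p' = o.+1 + o')%N ->
    W p p' o.+1 o' + W p.+1 p' o.+1 o'.+1
      <= W p.+1 p' o.+2 o' + W p p' o o'.+1;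
  submodular : forall p p' o o', (p + p' = o + o')%N ->
    W p p' o o' + W p.+1 p'.+1 o.+1 o'.+1
      <= W p.+1 p' o.+1 o' + W p p'.+1 o o'.+1 }.

Section Consequences.
Variable W : nat -> nat -> nat -> nat -> R.
Hypothesis sW : structured W.

Lemma monotone12 p p' o o' : (p + p' = o + o')%N ->
  W p p' o o' <= W p.+1 p' o o'.+1.
Proof.
by move=> h; rewrite -(swap_outputs sW) -[leRHS](swap_outputs sW);
  apply: monotone11 => //; lia.
Qed.

Lemma monotone21 p p' o o' : (p + p' = o + o')%N ->
  W p p' o o' <= W p p'.+1 o.+1 o'.
Proof.
by move=> h; rewrite -(swap_inputs sW) -[leRHS](swap_inputs sW);
  apply: monotone11 => //; lia.
Qed.

Lemma monotone22 p p' o o' : (p + p' = o + o')%N ->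
  W p p' o o' <= W p p'.+1 o o'.+1.
Proof.
by move=> h; rewrite -(swap_inputs sW) -[leRHS](swap_inputs sW);
  apply: monotone12 => //; lia.
Qed.

Lemma superconvex_swap p p' o o' : (p + p' = o + o'.+1)%N ->
  W p p' o o'.+1 + W p.+1 p' o.+1 o'.+1
    <= W p.+1 p' o o'.+2 + W p p' o.+1 o'.
Proof.
move=> h; have := @superconvex _ sW p p' o' o ltac:(lia).
by rewrite (swap_outputs sW p p' o o'.+1) (swap_outputs sW p.+1 p' o.+1 o'.+1)
  (swap_outputs sW p.+1 p' o o'.+2) (swap_outputs sW p p' o.+1 o').
Qed.

(** Superconvexity for the direction from output 1 to output 2, added to the
    one for the opposite direction. *)
Lemma convex_shift p p' o o' : (p + p' = o + o' + 2)%N ->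
  W p p' o.+1 o'.+1 *+ 2 <= W p p' o.+2 o' + W p p' o o'.+2.
Proof.
wlog: p p' / (0 < p)%N => [th h|].
  case: (posnP p) => [p0|]; last by move/th; apply.
  by rewrite -!(swap_inputs sW p); apply: th; lia.
case: p => // p _ h.
have := @superconvex _ sW p p' o o'; have := @superconvex_swap p p' o o'.
move=> /(_ ltac:(lia)) h1 /(_ ltac:(lia)) h2; lra.
Qed.

(** A function on an interval that is convex and symmetric about the midpoint
    is monotone in the distance to the midpoint: with the loads of the inputs
    fixed, the more even loads of the outputs are cheaper.  Convexity moves the
    inequality two steps towards the midpoint, where it is an equality by
    symmetry or an instance of convexity. *)
Lemma balanced p p' o o' : (p + p' = (o + o').+1)%N -> (o' <= o)%N ->
  W p p' o o'.+1 <= W p p' o.+1 o'.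
Proof.
move=> h /subnK e; move: h; rewrite -{}e; move: (o - o')%N => k.
have [n] := ubnP k; elim: n k o' => // n IH [|[|k]] o' kn h.
- by rewrite add0n (swap_outputs sW).
- have := @convex_shift p p' o' o' ltac:(lia).
  by rewrite add1n (swap_outputs sW p p' o'.+2 o'); lra.
have h1 := IH k o'.+1 ltac:(lia) ltac:(lia).
have := @convex_shift p p' (k.+1 + o')%N o' ltac:(lia).
by move: h1; rewrite !addnS !addSn; lra.
Qed.

Lemma serve_symmetric : symmetric (serve W).
Proof.
split=> p p' o o'; rewrite /serve.
- by rewrite minnC maxnC.
- by rewrite (minnC o) (maxnC o).
- by rewrite (transpose sW) andbC.
Qed.
Let sS := serve_symmetric.

Lemma serve_both p p' o o' : serve W p.+1 p'.+1 o.+1 o'.+1 = W p p' o o'.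
Proof.
rewrite /serve !minnSS !maxnSS /= !subn1 /=.
by case: (leqP p p') => _; case: (leqP o o') => _;
  rewrite ?(swap_inputs sW p p') ?(swap_outputs sW _ _ o o').
Qed.

End Consequences.

(** * States in which all the jobs share a port *)

(** All the jobs share a port, [k] and [l] of them in its two queues; by
    symmetry it does not matter which port this is. *)
Definition one_sided W (k l : nat) : R := W (k + l)%N 0%N k l.

Section OneSided.
Variable W : nat -> nat -> nat -> nat -> R.
Hypothesis sW : symmetric W.

Lemma input1_only p k l : p = (k + l)%N -> W p 0 k l = one_sided W k l.
Proof. by move->. Qed.

Lemma input2_only p k l : p = (k + l)%N -> W 0 p k l = one_sided W k l.
Proof. by move->; rewrite (swap_inputs sW). Qed.

Lemma output1_only p k l : p = (k + l)%N -> W k l p 0 = one_sided W k l.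
Proof. by move->; rewrite (transpose sW). Qed.

Lemma output2_only p k l : p = (k + l)%N -> W k l 0 p = one_sided W k l.
Proof. by move->; rewrite (transpose sW) (swap_inputs sW). Qed.

Lemma one_sidedC k l : one_sided W l k = one_sided W k l.
Proof. by rewrite /one_sided addnC (swap_outputs sW). Qed.

End OneSided.

Section ServeOneSided.
Variable W : nat -> nat -> nat -> nat -> R.
Hypothesis sW : structured W.
Let sS := serve_symmetric sW.
Notation G := (one_sided W).
Notation H := (one_sided (serve W)).

Lemma one_sided_monotonel k l : G k l <= G k.+1 l.
Proof. by rewrite /one_sided addSn; apply: monotone11 => //; lia. Qed.

Lemma one_sided_monotoner k l : G k l <= G k l.+1.
Proof. by rewrite -(one_sidedC sW) -[leRHS](one_sidedC sW) one_sided_monotonel. Qed.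

Lemma one_sided_supermodular k l : G k.+1 l + G k l.+1 <= G k.+1 l.+1 + G k l.
Proof.
have := @supermodular _ sW k l (k + l) 0 ltac:(lia).
by rewrite !(output1_only sW); first lra; lia.
Qed.

Lemma one_sided_superconvexl k l : G k.+1 l + G k.+1 l.+1 <= G k.+2 l + G k l.+1.
Proof.
have := @superconvex _ sW (k + l).+1 0 k l ltac:(lia).
by rewrite !(input1_only W) //; lia.
Qed.

Lemma one_sided_superconvexr k l : G k l.+1 + G k.+1 l.+1 <= G k l.+2 + G k.+1 l.
Proof.
have := one_sided_superconvexl l k.
by rewrite (one_sidedC sW k l.+1) (one_sidedC sW k.+1 l.+1)
  (one_sidedC sW k l.+2) (one_sidedC sW k.+1 l).
Qed.

Lemma one_sided_convex_shift k l : G k.+1 l.+1 *+ 2 <= G k.+2 l + G k l.+2.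
Proof. have := one_sided_superconvexl k l; have := one_sided_superconvexr k l; lra. Qed.

Lemma one_sided_convex k l : G k.+1 l *+ 2 <= G k.+2 l + G k l.
Proof. have := one_sided_superconvexl k l; have := one_sided_supermodular k l; lra. Qed.

Lemma one_sided_balancedl k l : (l <= k)%N -> G k l.+1 <= G k.+1 l.
Proof. by move=> h; rewrite /one_sided addSnnS; apply: balanced => //; lia. Qed.

Lemma one_sided_balancedr k l : (k <= l)%N -> G k.+1 l <= G k l.+1.
Proof. by move=> h; rewrite -(one_sidedC sW) -[leRHS](one_sidedC sW) one_sided_balancedl. Qed.

Lemma serve_one_sided0 : H 0 0 = G 0 0.
Proof. by []. Qed.

Lemma serve_longerl k l : (l <= k.+1)%N -> H k.+1 l = G k l.
Proof.
move=> h; rewrite /one_sided /serve maxn0 minn0 (maxn_idPl h) (minn_idPr h).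
by rewrite !subn0.
Qed.

Lemma serve_longerr k l : (k <= l.+1)%N -> H k l.+1 = G k l.
Proof. by move=> h; rewrite -(one_sidedC sS) -(one_sidedC sW) serve_longerl. Qed.

(** Serving the longer of two conflicting queues leaves the more even pair,
    which is the cheaper one by [balanced]. *)
Lemma serve_one_sided_lel k l : H k.+1 l <= G k l.
Proof.
have [h|] := leqP l k.+1; first by rewrite serve_longerl.
by case: l => // l h; rewrite serve_longerr ?one_sided_balancedr //; lia.
Qed.

Lemma serve_one_sided_ler k l : H k l.+1 <= G k l.
Proof. by rewrite -(one_sidedC sS) -(one_sidedC sW) serve_one_sided_lel. Qed.

Lemma serve_one_sidedP k l :
  [\/ [/\ k = 0, l = 0 & H k l = G 0 0],
    exists2 k', k = k'.+1 & (l <= k)%N /\ H k l = G k' l |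
    exists2 l', l = l'.+1 & (k < l)%N /\ H k l = G k l']%N.
Proof.
have [h|] := leqP l k.
  case: k h => [|k h]; first by rewrite leqn0 => /eqP ->; constructor 1.
  by constructor 2; exists k; rewrite // serve_longerl //.
by case: l => // l h; constructor 3; exists l; rewrite // serve_longerr //; lia.
Qed.

End ServeOneSided.

(** * Service preserves the structure *)

Section Preservation.
Variable W : nat -> nat -> nat -> nat -> R.
Hypothesis sW : structured W.
Let sS := serve_symmetric sW.
Notation G := (one_sided W).
Notation H := (one_sided (serve W)).

Ltac fold_one_sided :=
  rewrite ?(serve_both sW) ?(input1_only W) ?(input2_only sW) ?(output1_only sW)
    ?(output2_only sW)
  ?(input1_only (serve W)) ?(input2_only sS) ?(output1_only sS) ?(output2_only sS);
    try lia.

Lemma serve_one_sided_monotone k l : H k l <= H k.+1 l.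
Proof.
case: (serve_one_sidedP sW k.+1 l) => [[]|[k' [<-] [_ ->]]|[l' -> [h ->]]] //.
  case: k => [|k]; last exact: le_trans (serve_one_sided_lel sW _ _)
    (one_sided_monotonel sW _ _).
  by case: l => [|l] //;
    apply: le_trans (serve_one_sided_ler sW _ _) (one_sided_monotoner sW _ _).
exact: le_trans (serve_one_sided_ler sW _ _) (one_sided_monotonel sW _ _).
Qed.

(** The larger queue is served in all four states when [l < k], which is an
    instance of supermodularity; on the diagonal [k = l] the service alternates
    between the queues and convexity in one queue takes its place. *)
Lemma serve_one_sided_supermodular k l : H k.+1 l + H k l.+1 <= H k.+1 l.+1 + H k l.
Proof.
wlog hkl : k l / (l <= k)%N => [th|].
  have [|/ltnW] := leqP l k; first exact: th.
  move=> /th; rewrite (one_sidedC sS k l) (one_sidedC sS k.+1 l).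
  by rewrite (one_sidedC sS k l.+1) (one_sidedC sS k.+1 l.+1) addrC.
rewrite [H k.+1 l.+1](serve_longerl W) //.
have := serve_one_sided_lel sW k l; have := serve_one_sided_ler sW k l.
move: hkl; rewrite leq_eqVlt => /predU1P[->|].
  case: k => [|k]; first by rewrite (serve_one_sided0 W);
    have := one_sided_monotoner sW 0 0; lra.
  rewrite (serve_longerl W (leqnn _)) (one_sidedC sW k.+2 k.+1).
  by have := one_sided_convex sW k k.+1; lra.
case: k => // k hkl; rewrite [H k.+1 l](serve_longerl W) 1?ltnW //.
have := serve_one_sided_lel sW k l.+1; have := one_sided_supermodular sW k l; lra.
Qed.

Lemma serve_one_sided_superconvex k l : H k.+1 l + H k.+1 l.+1 <= H k.+2 l + H k l.+1.
Proof.
have [hlt|hge] := ltnP k l.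
  case: l hlt => // l; rewrite ltnS leq_eqVlt => /predU1P[<-|hlt].
    have := serve_longerl W (leqW (leqnn k.+1)); have := serve_longerl W (leqnn k.+1).
    have := serve_one_sided_ler sW k.+1 k.+1;
      have := serve_longerr sW (leqW (leqW (leqnn k))); lra.
  have := serve_longerr sW (hlt : k.+2 <= l.+1)%N;
    have := serve_longerr sW (leqW (leqW (ltnW hlt))).
  have := serve_one_sided_ler sW k.+1 l; have := serve_one_sided_ler sW k.+1 l.+1.
  by have := one_sided_superconvexl sW k l; lra.
have := serve_longerl W (leqW (leqW hge)); have := serve_one_sided_lel sW k l;
  have := serve_one_sided_lel sW k l.+1.
case: k hge => [|k]; first rewrite leqn0 => /eqP ->.
  by have := @serve_longerr W sW 0 0 isT; rewrite (one_sidedC sW 1); lra.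
rewrite leq_eqVlt => /predU1P[->|hlt].
  by have := @serve_longerr W sW k.+1 k.+1 (leqW (leqnn _));
    rewrite (one_sidedC sW k.+2); lra.
by have := serve_longerl W hlt; have := one_sided_superconvexl sW k l; lra.
Qed.

(** If no port is empty in any of the four states, they all lose the same jobs
    and this is superconvexity.  Otherwise all the jobs of some of the states
    share a port, and which queue is the longest decides which structural
    inequality is needed. *)
Lemma serve_superconvex p p' o o' : (p + p' = o.+1 + o')%N ->
  serve W p p' o.+1 o' + serve W p.+1 p' o.+1 o'.+1
      <= serve W p.+1 p' o.+2 o' + serve W p p' o o'.+1.
Proof.
case: p' => [|p'] h; first by fold_one_sided; apply: serve_one_sided_superconvex.
case: p h => [|p] h; first case: o' h => [|o'] h.
(* Without the new job, only queue (2, 1) is non-empty. *)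
- have e : p' = o by lia.
  subst p'; fold_one_sided.
  rewrite (serve_longerl W) // (@serve_longerr W sW 1 o) //.
  case: o {h} => [|k]; first by rewrite (serve_longerr sW) //;
    have := one_sided_monotonel sW 0 0; lra.
  rewrite (serve_longerl W) //; have := @superconvex _ sW 0 k.+1 k 0 ltac:(lia).
  have := @monotone12 _ sW 0 k.+1 k.+1 0 ltac:(lia).
  by fold_one_sided; lra.
(* Without the new job, input 1 is empty. *)
- fold_one_sided; have [hle|hgt] := leqP o o'.+2.
    by rewrite (serve_longerr sW hle); have := serve_one_sided_lel sW o o'.+1;
      have := serve_one_sided_ler sW o.+1 o'; lra.
  case: o h hgt => // o h hgt; rewrite [H o.+1 _](serve_longerl W); last lia.
  by have := serve_one_sided_lel sW o.+1 o'.+1; have := one_sided_convex_shift sW o o';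
    lra.
case: o h => [|o] h; case: o' h => [|o'] h; try lia.
(* Output 1 is empty in the last state. *)
- fold_one_sided; have [hle|hgt] := leqP p p'.
    rewrite (serve_longerr sW) //; have := @monotone11 _ sW p p' 0 o' ltac:(lia).
    by fold_one_sided; lra.
  rewrite (serve_longerl W); last lia.
  have := @submodular _ sW p p' 0 o' ltac:(lia).
  have := @monotone21 _ sW p.+1 p' 0 o'.+1 ltac:(lia).
  by fold_one_sided; lra.
(* Output 2 is empty in two of the states. *)
- fold_one_sided; have [hle|hgt] := leqP p' p.+1.
    rewrite [H p.+2 _](serve_longerl W); last lia.
    by have := serve_one_sided_lel sW p p'.+1; have := one_sided_supermodular sW p p';
      lra.
  rewrite [H p.+2 _](serve_longerr sW); last lia.
  by have := serve_one_sided_ler sW p.+1 p'; have := one_sided_convex sW p p'; lra.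
by fold_one_sided; apply: superconvex => //; lia.
Qed.

Lemma serve_monotone p p' o o' : (p + p' = o + o')%N ->
  serve W p p' o o' <= serve W p.+1 p' o.+1 o'.
Proof.
case: p' => [|p'] h; first by fold_one_sided; apply: serve_one_sided_monotone.
case: o' h => [|o'] h; first by fold_one_sided; apply: serve_one_sided_monotone.
case: p h => [|p] h; first by fold_one_sided; apply: serve_one_sided_ler.
case: o h => [|o] h; first by fold_one_sided; apply: serve_one_sided_ler.
by fold_one_sided; apply: monotone11 => //; lia.
Qed.

Lemma serve_supermodular p p' o o' : (p + p' = o + o')%N ->
  serve W p.+1 p' o.+1 o' + serve W p p'.+1 o.+1 o'
      <= serve W p.+1 p'.+1 o.+2 o' + serve W p p' o o'.
Proof.
wlog: p p' / (p <= p')%N => [th h|].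
  have [|/ltnW] := leqP p p'; first by move/th; apply.
  move/th => /(_ ltac:(lia)).
  rewrite (swap_inputs sS p.+1 p') (swap_inputs sS p p'.+1).
  by rewrite (swap_inputs sS p.+1 p'.+1) (swap_inputs sS p p') addrC.
case: o' => [|o'] + h; first by fold_one_sided; rewrite serve_one_sided_supermodular.
case: p' h => [|p'] h hle; first lia.
case: p h hle => [|p] h hle.
  fold_one_sided; have [ho|ho] := leqP o o'.+1.
    by rewrite [H o _](serve_longerr sW) //; have := serve_one_sided_ler sW o.+1 o';
      lra.
  case: o h ho => // o h ho; rewrite [H o.+1 _](serve_longerl W); last lia.
  by have := serve_one_sided_lel sW o.+1 o'.+1; have := one_sided_superconvexl sW o o';
    lra.
case: o h => [|o] h; last by fold_one_sided; apply: supermodular => //; lia.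
have := @monotone11 _ sW p p'.+1 0 o' ltac:(lia).
have := @monotone21 _ sW p.+1 p' 0 o' ltac:(lia).
fold_one_sided; case: (serve_one_sidedP sW p.+1 p'.+1) => [[]|[k [<-] [_ ->]]|[k [<-]
  [_ ->]]] //; lra.
Qed.

(** The state with one more job in each of the queues (1, 1) and (2, 2) is
    served into the original state, whence the term [W 0 p' o o']. *)
Lemma serve_submodular_one p' o o' : (p' = o + o')%N ->
  serve W 0 p' o o' + W 0%N p' o o'
     <= serve W 1 p' o.+1 o' + serve W 0 p'.+1 o o'.+1.
Proof.
case: p' => [|p'] h.
  have -> : o = 0%N by lia.
  have -> : o' = 0%N by lia.
  fold_one_sided; rewrite (serve_one_sided0 W) (serve_longerl W) //
    (serve_longerr sW) //.
case: o h => [|o] h; case: o' h => [|o'] h; try lia.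
- by fold_one_sided; rewrite !(serve_longerr sW) // addrC.
- have e : p' = o by lia.
  subst p'; fold_one_sided;
    rewrite [H o.+1 0](serve_longerl W) // (@serve_longerr _ sW 1 o) //
      (serve_longerl W) //.
  have := @monotone12 _ sW 0 o.+1 o.+1 0 ltac:(lia).
  have := @submodular _ sW 0 o o 0 ltac:(lia).
  by fold_one_sided; lra.
fold_one_sided; have [hle|hgt] := leqP o o'.+1.
  by rewrite [H o.+1 o'.+2](serve_longerr sW) //;
    have := serve_one_sided_ler sW o.+1 o'; lra.
rewrite [H o.+1 o'.+2](serve_longerl W); last lia.
by have := serve_one_sided_lel sW o o'.+1; have := one_sided_superconvexr sW o o'; lra.
Qed.

Lemma serve_submodular p p' o o' : (p + p' = o + o')%N ->
  serve W p p' o o' + serve W p.+1 p'.+1 o.+1 o'.+1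
      <= serve W p.+1 p' o.+1 o' + serve W p p'.+1 o o'.+1.
Proof.
rewrite (serve_both sW).
case: p => [|p] h; first by apply: serve_submodular_one; lia.
case: o h => [|o] h.
  have := @serve_submodular_one o' p.+1 p' ltac:(lia).
  by rewrite (transpose sS _ _ 0) (transpose sW _ _ 0%N) (transpose sS p.+2)
    (transpose sS p.+1).
case: p' h => [|p'] h.
  have := @serve_submodular_one p.+1 o' o.+1 ltac:(lia).
  rewrite (swap_inputs sS p.+1) (swap_inputs sW p.+1) (swap_inputs sS p.+1 1).
  rewrite (swap_inputs sS p.+2 0) (swap_outputs sS _ _ o.+1) (swap_outputs sW _ _ o.+1).
  by rewrite (swap_outputs sS _ _ o.+1 o'.+1) (swap_outputs sS _ _ o.+2 o')
    [leRHS]addrC.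
case: o' h => [|o'] h; last by fold_one_sided; apply: submodular => //; lia.
have := @serve_submodular_one o.+1 p'.+1 p.+1 ltac:(lia).
rewrite (transpose sS p'.+1 p.+1) (transpose sW p'.+1 p.+1) (transpose sS p'.+2 p.+1).
rewrite (transpose sS p'.+1 p.+2) (swap_inputs sS p.+1 p'.+1)
  (swap_inputs sW p.+1 p'.+1).
rewrite (swap_inputs sS p.+2 p'.+1) (swap_inputs sS p.+1 p'.+2).
rewrite (swap_outputs sS _ _ o.+1 0) (swap_outputs sW _ _ o.+1 0%N).
by rewrite (swap_outputs sS _ _ o.+2 0) (swap_outputs sS _ _ o.+1 1) [leRHS]addrC.
Qed.

End Preservation.

(** * Schedules acting on the loads *)

(** The queues [a], [b], [c], [d] are (1, 1), (1, 2), (2, 1) and (2, 2). *)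
Definition loads_of (V : Type) (W : nat -> nat -> nat -> nat -> V)
  (a b c d : nat) : V := W (a + b)%N (c + d)%N (a + c)%N (b + d)%N.

Lemma loads_swap_outputs W a b c d : symmetric W ->
  loads_of W b a d c = loads_of W a b c d.
Proof. by move=> sW; rewrite /loads_of (addnC b a) (addnC d c) (swap_outputs sW). Qed.

Lemma loads_swap_inputs W a b c d : symmetric W ->
  loads_of W c d a b = loads_of W a b c d.
Proof. by move=> sW; rewrite /loads_of (addnC c a) (addnC d b) (swap_inputs sW). Qed.

Lemma loads_mono W a b c d a' b' c' d' : structured W ->
  (a <= a')%N -> (b <= b')%N -> (c <= c')%N -> (d <= d')%N ->
  loads_of W a b c d <= loads_of W a' b' c' d'.
Proof.
move=> sW /subnK <- /subnK <- /subnK <- /subnK <-.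
have step (f : nat -> R) n m : (forall i, f i <= f i.+1) -> f n <= f (m + n)%N.
  by move=> fS; elim: m => // m IH; apply: le_trans IH (fS _).
apply: (@le_trans _ _ (loads_of W (a' - a + a)%N b c d)).
  apply: (step (fun i => loads_of W i b c d)) => i /=.
  by rewrite /loads_of !addSn; apply: monotone11 => //; lia.
apply: (@le_trans _ _ (loads_of W (a' - a + a)%N (b' - b + b)%N c d)).
  apply: (step (fun i => loads_of W _ i c d)) => i /=.
  by rewrite /loads_of !(addSn, addnS); apply: monotone12 => //; lia.
apply: (@le_trans _ _ (loads_of W (a' - a + a)%N (b' - b + b)%N (c' - c + c)%N d)).
  apply: (step (fun i => loads_of W _ _ i d)) => i /=.
  by rewrite /loads_of !(addSn, addnS); apply: monotone21 => //; lia.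
apply: (step (fun i => loads_of W _ _ _ i)) => i /=.
by rewrite /loads_of !(addSn, addnS); apply: monotone22 => //; lia.
Qed.

Lemma serve_one_sided_le W k l : structured W -> one_sided
  (serve W) k l <= one_sided W k l.
Proof.
move=> sW; case: k => [|k];
  last exact: le_trans (serve_one_sided_lel sW _ _) (one_sided_monotonel sW _ _).
by case: l => [|l] //;
  apply: le_trans (serve_one_sided_ler sW _ _) (one_sided_monotoner sW _ _).
Qed.

(** Serving (1, 1) and (2, 2) is one of the choices of [serve], or is worse: if
    another schedule has size 2 then a job is wasted, and if none has then
    [balanced] favours the longest queue. *)
Lemma serve_le_diagonal W a b c d : structured W ->
  loads_of (serve W) a b c d <= loads_of W a.-1 b c d.-1.
Proof.
move=> sW; have sS := serve_symmetric sW.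
have mono a b c d := @loads_mono W a b c d.
case: a b c d => [|a] [|b] [|c] [|d]; rewrite /loads_of ?(addn0,add0n,addSn,addnS) /=;
rewrite ?(serve_both sW) ?(input1_only W) ?(input2_only sW) ?(output1_only sW)
  ?(output2_only sW)
  ?(input1_only (serve W)) ?(input2_only sS) ?(output1_only sS) ?(output2_only sS) //.
all: try exact: serve_one_sided_lel.
all: try exact: serve_one_sided_ler.
all: try exact: serve_one_sided_le.
all: try (by apply: monotone11 => //; lia).
all: try (by apply: monotone22 => //; lia).
all: try lia.
apply: (@le_trans _ _ (W b.+1 c c b.+1)); first by apply: monotone12 => //; lia.
by apply: monotone21 => //; lia.
Qed.

Lemma serve_le_antidiagonal W a b c d : structured W ->
  loads_of (serve W) a b c d <= loads_of W a b.-1 c.-1 d.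
Proof.
move=> sW; have := serve_le_diagonal b a d c sW.
by rewrite (loads_swap_outputs _ _ _ _ (serve_symmetric sW))
  (loads_swap_outputs _ _ _ _ sW).
Qed.

Lemma serve_diagonal W a b c d : structured W -> (0 < a)%N -> (0 < d)%N ->
  loads_of W a.-1 b c d.-1 = loads_of (serve W) a b c d.
Proof.
move=> sW; case: a => // a _; case: d => // d _.
by rewrite /loads_of !addSn !addnS serve_both.
Qed.

Lemma serve_antidiagonal W a b c d : structured W -> (0 < b)%N -> (0 < c)%N ->
  loads_of W a b.-1 c.-1 d = loads_of (serve W) a b c d.
Proof.
move=> sW; case: b => // b _; case: c => // c _.
by rewrite /loads_of !addSn !addnS serve_both.
Qed.

Lemma serve_longest11 W a b c d : structured W ->
  (a == 0)%N || (d == 0)%N -> (b == 0)%N || (c == 0)%N ->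
  (0 < a)%N -> (b <= a)%N -> (c <= a)%N ->
  loads_of W a.-1 b c d = loads_of (serve W) a b c d.
Proof.
move=> sW; have sS := serve_symmetric sW.
case: a d => // a [|//] _ /orP[]/eqP-> _ h1 h2; rewrite /loads_of ?(addn0,add0n,addSn).
  by rewrite (output1_only sW) // (output1_only sS) // ?(serve_longerl W) //; lia.
by rewrite (input1_only W) // (input1_only (serve W)) ?(serve_longerl W) //; lia.
Qed.

(** The automorphisms of the square of conflicting queues carry any queue to
    queue (1, 1). *)
Lemma serve_longest W a b c d : structured W ->
  (a == 0)%N || (d == 0)%N -> (b == 0)%N || (c == 0)%N ->
  [/\ (0 < a -> b <= a -> c <= a -> d <= a ->
       loads_of W a.-1 b c d = loads_of (serve W) a b c d),
      (0 < b -> a <= b -> c <= b -> d <= b ->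
       loads_of W a b.-1 c d = loads_of (serve W) a b c d),
      (0 < c -> a <= c -> b <= c -> d <= c ->
       loads_of W a b c.-1 d = loads_of (serve W) a b c d) &
      (0 < d -> a <= d -> b <= d -> c <= d ->
       loads_of W a b c d.-1 = loads_of (serve W) a b c d)]%N.
Proof.
move=> sW had hbc; have sS := serve_symmetric sW; split=> *.
- exact: serve_longest11.
- rewrite -(loads_swap_outputs _ _ _ _ sW) -(loads_swap_outputs _ _ _ _ sS).
  exact: serve_longest11.
- rewrite -(loads_swap_inputs _ _ _ _ sW) -(loads_swap_inputs _ _ _ _ sS).
  by apply: serve_longest11; rewrite 1?orbC.
rewrite -(loads_swap_inputs _ _ _ _ sW) -(loads_swap_inputs _ _ _ _ sS).
rewrite -(loads_swap_outputs _ _ _ _ sW) -(loads_swap_outputs _ _ _ _ sS).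
by apply: serve_longest11; rewrite 1?orbC.
Qed.

Lemma bellman_structured W (beta : R) : 0 <= beta -> structured W ->
  structured (bellman beta W).
Proof.
move=> b0 sW.
have succ_natr (m n : nat) : ((m + n).+1%:R = (m + n)%:R + 1 :> R) *
    ((m + n).+2%:R = (m + n)%:R + 2 :> R) * ((m + n).+3%:R = (m + n)%:R + 3 :> R) *
    ((m + n).+4%:R = (m + n)%:R + 4 :> R).
  by rewrite -(addn4 (m + n)) -(addn3 (m + n)) -(addn2 (m + n)) -(addn1 (m + n)) !(natrD _ (m + n)).
have sS := serve_symmetric sW; rewrite /bellman.
split; first split=> p p' o o'.
- by rewrite (swap_inputs sS) (addnC p').
- by rewrite (swap_outputs sS) addnAC.
- by rewrite (transpose sS) -addnA addnC addnA.
- move=> p p' o o' h; have := serve_monotone sW h => /(ler_wpM2l b0).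
  by rewrite !(addSn, addnS) ?succ_natr; lra.
- move=> p p' o o' h; have := serve_supermodular sW h => /(ler_wpM2l b0).
  by rewrite !mulrDr !(addSn, addnS) ?succ_natr; lra.
- move=> p p' o o' h; have := serve_superconvex sW h => /(ler_wpM2l b0).
  by rewrite !mulrDr !(addSn, addnS) ?succ_natr; lra.
- move=> p p' o o' h; have := serve_submodular sW h => /(ler_wpM2l b0).
  by rewrite !mulrDr !(addSn, addnS) ?succ_natr; lra.
Qed.

End Structure.

(** * Algorithm 1 in terms of loads *)

Section States.

Lemma ord2P (i : 'I_2) : i = ord0 \/ i = ord_max.
Proof. by case: i => [[|[|//]] h]; [left|right]; apply: val_inj. Qed.

Lemma queueP (r : queue) : [\/ r = q11, r = q12, r = q21 | r = q22].
Proof.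
by case: r => i j; case: (ord2P i) => ->; case: (ord2P j) => ->;
  [constructor 1|constructor 2|constructor 3|constructor 4].
Qed.

Lemma big_ord2 (U : Type) (idx : U) (op : Monoid.law idx) (F : 'I_2 -> U) :
  \big[op/idx]_(i < 2) F i = op (F ord0) (F ord_max).
Proof. by rewrite big_ord_recl big_ord1; congr (op _ (F _)); apply: val_inj. Qed.

Lemma big_queue (U : Type) (idx : U) (op : Monoid.com_law idx) (F : queue -> U) :
  \big[op/idx]_r F r = op (op (F q11) (F q12)) (op (F q21) (F q22)).
Proof.
rewrite (eq_bigr (fun r : queue => F (r.1, r.2))); last by case.
by rewrite -(pair_bigA _ (fun i j => F (i, j))) !big_ord2.
Qed.

Definition unserved (x : state) (s : schedule) : state :=
  [ffun r => (x r - serves s r)%N].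

Definition state_loads (V : Type) (W : nat -> nat -> nat -> nat -> V) (x : state) : V :=
  loads_of W (x q11) (x q12) (x q21) (x q22).

Lemma schedule_cases (s : schedule) :
  (serves s q12 = false /\ serves s q21 = false) \/
  (serves s q11 = false /\ serves s q22 = false).
Proof.
have /andP[/forallP rows /forallP cols] := valP s.
move: (rows ord0) (rows ord_max) (cols ord0) (cols ord_max).
rewrite !big_ord2 /= /serves.
by do 4 (case: (val s _)); auto.
Qed.

(** Every schedule is contained in one of the two perfect matchings, and
    serving fewer queues leaves more jobs. *)
Lemma serve_le (R : realFieldType) (W : nat -> nat -> nat -> nat -> R) x s :
  structured W -> state_loads (serve W) x <= state_loads W (unserved x s).
Proof.
move=> sW; rewrite /state_loads !ffunE.
case: (schedule_cases s) => -[-> ->]; rewrite !subn0.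
  apply: le_trans (serve_le_diagonal _ _ _ _ sW) _.
  by apply: loads_mono => //; case: serves; lia.
apply: le_trans (serve_le_antidiagonal _ _ _ _ sW) _.
by apply: loads_mono => //; case: serves; lia.
Qed.

Definition schedule_of (f : {ffun queue -> bool}) (h : is_schedule f) : schedule :=
  exist _ f h.

Lemma is_schedule_diagonal (b : bool) :
  is_schedule [ffun r : queue => (r.1 == r.2) == b].
Proof.
apply/andP; split; apply/forallP => i; rewrite big_ord2 !ffunE /=;
by case: (ord2P i) => ->; case: b.
Qed.

Lemma is_schedule_single (r : queue) : is_schedule [ffun r' : queue => r' == r].
Proof.
apply/andP; split; apply/forallP => i; rewrite big_ord2 !ffunE /=;
by case: (ord2P i) => ->; case: (queueP r) => ->.
Qed.

Definition single r : schedule := schedule_of (is_schedule_single r).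

Lemma served_single (x : state) r : (0 < x r)%N -> served x (single r) = [set r]%SET.
Proof.
move=> xr; apply/setP => r'; rewrite !inE /serves ffunE.
by case: eqP => // ->.
Qed.

Lemma schedule_sizeE (x : state) (s : schedule) :
  schedule_size x s = (\sum_(r : queue) (serves s r && (0 < x r)))%N.
Proof.
by rewrite /schedule_size -sum1_card big_mkcond; apply: eq_bigr => r _; rewrite inE;
  case: andb.
Qed.

Lemma no_pair (x : state) : ~~ [exists s, schedule_size x s == 2%N] ->
  (x q11 == 0)%N || (x q22 == 0)%N /\ (x q12 == 0)%N || (x q21 == 0)%N.
Proof.
move=> /existsPn no2.
have := no2 (schedule_of (is_schedule_diagonal true)).
have := no2 (schedule_of (is_schedule_diagonal false)).
rewrite !schedule_sizeE !big_queue /serves /= !ffunE /=.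
by do 4 (case: (posnP (x _)) => ?).
Qed.

(** The second case also covers a single non-empty queue, which is then a
    longest one. *)
Lemma algorithm1_choiceP (x : state) s : algorithm1_choice x s ->
  [\/ schedule_size x s = 2%N,
      ~~ [exists s, schedule_size x s == 2%N] /\
        exists2 r, served x s = [set r]%SET & forall r', (x r' <= x r)%N |
      forall r, x r = 0%N].
Proof.
rewrite /algorithm1_choice; case: ifPn => [_ /eqP|no2]; first by constructor 1.
case: ifPn => [_|no11].
  move=> /existsP[r /andP[/eqP rs /forallP rmax]]; constructor 2; split => //.
  exists r => // r'; have [->|r'0] := posnP (x r'); first by [].
  by have /forallP/(_ r') := rmax (single r'); rewrite served_single // eqxx.
case: ifPn => [_ s1|no1 _].
  have /cards1P[r rs] := s1; constructor 2; split => //; exists r => // r'.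
  have [->|r'0] := posnP (x r'); first by []; have [->|nr] := eqVneq r' r; first by [].
  case/negP: no11; apply/existsP; exists (single r'); apply/existsP; exists s.
  by rewrite s1 /schedule_size rs served_single // cards1 eqxx /= (inj_eq set1_inj).
constructor 3 => r; apply/eqP; rewrite -leqn0 leqNgt; apply: contra no1 => r0.
by apply/existsP; exists (single r); rewrite /schedule_size served_single // cards1.
Qed.

Lemma algorithm1_choice_exists (x : state) : exists s, algorithm1_choice x s.
Proof.
rewrite /algorithm1_choice; case: [exists s', schedule_size x s' == 2%N] / boolP.
  by move=> /existsP.
move=> _; case: [exists s1, _] / boolP => [|_].
  move=> /existsP[s1 /existsP[_ /and3P[/cards1P[r1 r1s] _ _]]].
  have [r rmax] := arg_maxnP (fun r => x r) (isT : xpredT r1).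
  have : r1 \in served x s1 by rewrite r1s inE.
  rewrite inE => /andP[_ r1pos] rge; exists (single r); apply/existsP; exists r.
  rewrite served_single ?eqxx /=; last exact: leq_trans (rge r1 isT).
  by apply/forallP => s'; apply/forallP => r'; apply/implyP => _; apply: rge.
case: [exists s', schedule_size x s' == 1%N] / boolP; first by move=> /existsP.
by exists (single q11).
Qed.

(** The value depends on the state through its port loads only, and all the
    schedules of size 2 change the loads in the same way: this is why ties may
    be broken arbitrarily. *)
Lemma serve_algorithm1 (R : realFieldType) (W : nat -> nat -> nat -> nat -> R) x s :
  structured W -> algorithm1_choice x s ->
  state_loads W (unserved x s) = state_loads (serve W) x.
Proof.
move=> sW /algorithm1_choiceP[s2|[/no_pair[had hbc]] [r rs rmax]|x0].
- move: s2; rewrite schedule_sizeE big_queue /state_loads !ffunE.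
  case: (schedule_cases s) => -[-> ->] /=; rewrite ?add0n ?addn0 ?subn0.
    case: (serves s q11); case: (serves s q22); case: posnP => //= a0;
      case: posnP => //= d0 _.
    by rewrite !subn1 serve_diagonal.
  case: (serves s q12); case: (serves s q21); case: posnP => //= a0;
    case: posnP => //= d0 _.
  by rewrite !subn1 serve_antidiagonal.
- have u r' : unserved x s r' = (x r' - (r' == r))%N.
    have /setP/(_ r') := rs; rewrite !inE ffunE => <-.
    by have [->|] := posnP (x r'); rewrite ?sub0n ?andbT.
  have : r \in served x s by rewrite rs inE.
  rewrite inE => /andP[_ rpos].
  have [l1 l2 l3 l4] := serve_longest sW had hbc.
  rewrite /state_loads !u.
  by case: (queueP r) rpos rmax => -> rpos rmax;
    rewrite /= ?subn0 subn1 (l1, l2, l3, l4).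
by rewrite /state_loads !ffunE !x0 !sub0n.
Qed.

End States.

(** * Integrals of discrete random variables *)

Section Discrete.
Local Open Scope ereal_scope.
Context (d : measure_display) (T : measurableType d) (R : realType).
Variable P : probability T R.

Definition discrete (C : countType) (X : T -> C) : Prop :=
  forall c, measurable [set w | X w = c].

Section OneVariable.
Variables (C : countType) (X : T -> C).
Hypothesis dX : discrete X.

Lemma discrete_preimage (Y : set C) : measurable [set w | Y (X w)].
Proof.
rewrite (_ : [set _ | _] = \bigcup_(n : nat)
    [set w | exists2 c, pickle_inv n = Some c & Y c /\ X w = c]).
  apply: bigcup_measurable => n _.
  case: (pickle_inv n) => [c|]; last first.
    by rewrite (_ : [set _ | _] = set0) //; apply/seteqP; split=> w // [].
  have [Yc|nYc] := pselect (Y c).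
    rewrite (_ : [set _ | _] = [set w | X w = c]); first exact: dX.
    by apply/seteqP; split=> [w [_ [<-] []]//|w /= Xw]; exists c.
  rewrite (_ : [set _ | _] = set0) //; apply/seteqP; split=> w //.
  by move=> [_ [<-] []].
apply/seteqP; split=> [w Yw|w [n _ [c _ [Yc Xc]]]] /=; last by rewrite Xc.
by exists (pickle (X w)) => //; exists (X w) => //; apply: pickleK_inv.
Qed.

Lemma discrete_measurable_fun (f : C -> \bar R) (D : set T) :
  measurable_fun D (fun w => f (X w)).
Proof.
move=> mD Y _; apply: measurableI => //.
exact: (discrete_preimage (f @^-1` Y)).
Qed.

Definition atom (n : nat) : set T := [set w | pickle (X w) = n].

Lemma measurable_atom n : measurable (atom n).
Proof. exact: (discrete_preimage [set c | pickle c = n]). Qed.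

Lemma atomE n : atom n = if pickle_inv n is Some c then [set w | X w = c] else set0.
Proof.
apply/seteqP; split=> w /=; first by move=> <-; rewrite pickleK_inv.
case E : (pickle_inv n) => [c|//] /= Xc; rewrite /atom /= Xc.
by have := @pickle_invK C n; rewrite E.
Qed.

Lemma integral_atoms (D : set T) (g : T -> \bar R) : measurable D ->
  measurable_fun D g -> (forall w, 0 <= g w) ->
  \int[P]_(w in D) g w = \sum_(0 <= n <oo) \int[P]_(w in D `&` atom n) g w.
Proof.
move=> mD mg g0.
have DE : D = \bigcup_n (D `&` atom n).
  apply/seteqP; split=> [w Dw|w [n _ []]//]; by exists (pickle (X w)).
rewrite {1}DE ge0_integral_bigcup //.
- by move=> n; apply: measurableI => //; apply: measurable_atom.
- by rewrite -DE.
- by move=> i j _ _ [w [[_ wi] [_ wj]]]; rewrite -wi -wj.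
Qed.

(** [pickle_inv] lists the countable type, so that sums over its values are
    series of extended reals. *)
Lemma integral_discrete (D : set T) (f : C -> \bar R) : measurable D ->
  (forall c, 0 <= f c) ->
  \int[P]_(w in D) f (X w) =
  \sum_(0 <= n <oo) oapp (fun c => f c * P (D `&` [set w | X w = c])) 0 (pickle_inv n).
Proof.
move=> mD f0; rewrite integral_atoms //; last exact: discrete_measurable_fun.
apply: eq_eseriesr => n _; rewrite atomE; case: pickle_inv => [c|] /=.
  rewrite -integral_cst; last by apply: measurableI => //; apply: dX.
  by apply: eq_integral => w; rewrite inE => -[_ /= ->].
by rewrite setI0 integral_set0.
Qed.

End OneVariable.

Lemma discrete_pair (C1 C2 : countType) (X : T -> C1) (Y : T -> C2) :
  discrete X -> discrete Y -> discrete (fun w => (X w, Y w)).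
Proof.
move=> dX dY [x y].
rewrite (_ : [set _ | _] = [set w | X w = x] `&` [set w | Y w = y]).
  by apply: measurableI; [exact: dX|exact: dY].
by apply/seteqP; split=> w /= [-> ->].
Qed.

Lemma eq_law_integral (C : countType) (X Y : T -> C) (f : C -> \bar R) :
  discrete X -> discrete Y -> (forall c, 0 <= f c) ->
  (forall c, P [set w | X w = c] = P [set w | Y w = c]) ->
  \int[P]_w f (X w) = \int[P]_w f (Y w).
Proof.
move=> dX dY f0 XY; rewrite !integral_discrete //.
by apply: eq_eseriesr => n _; case: pickle_inv => //= c; rewrite !setTI XY.
Qed.

Section Independent.
Variables (C1 C2 : countType) (X : T -> C1) (Y : T -> C2).
Hypotheses (dX : discrete X) (dY : discrete Y).
Hypothesis XY : forall x y, P ([set w | X w = x] `&` [set w | Y w = y]) =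
  P [set w | X w = x] * P [set w | Y w = y].

Lemma integral_indep_atom x (f : C2 -> \bar R) : (forall y, 0 <= f y) ->
  \int[P]_(w in [set w | X w = x]) f (Y w) =
  P [set w | X w = x] * \int[P]_w f (Y w).
Proof.
move=> f0; rewrite !integral_discrete //.
have Pfin : P [set w | X w = x] \is a fin_num by apply: fin_num_measure.
rewrite -(fineK Pfin) -nneseriesZl.
  apply: eq_eseriesr => n _; case: pickle_inv => [y|] /=; last by rewrite mule0.
  by rewrite setTI XY fineK // muleCA.
by move=> n _; case: pickle_inv => //= y; apply: mule_ge0.
Qed.

(** A Fubini theorem for independent discrete variables: condition on the value
    of [X]. *)
Lemma integral_indep (f : C1 -> C2 -> \bar R) : (forall x y, 0 <= f x y) ->
  \int[P]_w f (X w) (Y w) = \int[P]_w \int[P]_w' f (X w) (Y w').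
Proof.
move=> f0.
have dXY := discrete_pair dX dY.
rewrite (integral_atoms dX) //; last first.
  exact: (discrete_measurable_fun dXY (fun xy => f xy.1 xy.2)).
rewrite (integral_discrete dX (f := fun x => \int[P]_w' f x (Y w'))) //; last first.
  by move=> x; apply: integral_ge0.
apply: eq_eseriesr => n _; rewrite setTI atomE; case: pickle_inv => [x|] /=.
  rewrite setTI muleC -integral_indep_atom //.
  by apply: eq_integral => w; rewrite inE => /= ->.
by rewrite integral_set0.
Qed.

End Independent.
End Discrete.

(** * The law of the arrivals *)

Section Arrivals.
Context (d : measure_display) (T : measurableType d) (R : realType).
Variables (P : probability T R) (A : queue -> nat -> {RV P >-> nat}).
Hypothesis A_indep : mutually_independent (fun i : queue * nat => A i.1 i.2).
Hypothesis A_ident : identically_distributed (fun i : queue * nat => A i.1 i.2).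

Notation arr := (arrivals A).

Lemma measurable_arrival r t (B : set nat) : measurable (A r t @^-1` B).
Proof. by rewrite -[_ @^-1` _]setTI; apply: measurable_funPT. Qed.

Lemma arrivals_eventE (us : seq nat) (a : nat -> state) :
  [set w | forall u, u \in us -> arr u w = a u] =
  \bigcap_(i in [set` [seq (r, u) | u <- us, r <- enum queue]])
    (A i.1 i.2 @^-1` [set a i.2 i.1]).
Proof.
apply/seteqP; split=> [w h i /= /allpairsP[[u r] /= [uus _ ->]] /=|w h u uus].
  by rewrite /preimage /= -(h u uus) ffunE.
apply/ffunP => r; rewrite ffunE; apply: (h (r, u)) => /=.
by apply/allpairsP; exists (u, r); split => //=; rewrite mem_enum.
Qed.

Lemma arrivals_event1 t (a : nat -> state) :
  [set w | arr t w = a t] = [set w | forall u, u \in [:: t] -> arr u w = a u].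
Proof.
apply/seteqP; split=> w /= h; first by move=> u; rewrite inE => /eqP->.
by apply: h; rewrite inE.
Qed.

Lemma probability_arrivals (us : seq nat) (a : nat -> state) : uniq us ->
  P [set w | forall u, u \in us -> arr u w = a u] =
  (\prod_(u <- us) \prod_r fine (P (A r u @^-1` [set a u r])))%:E.
Proof.
move=> us_uniq; rewrite arrivals_eventE.
have := @A_indep [seq (r, u) | u <- us, r <- enum queue] (fun i => [set a i.2 i.1]).
rewrite big_allpairs_dep /= => ->.
  by congr EFin; apply: eq_bigr => u _; rewrite big_enum.
apply: allpairs_uniq; rewrite ?enum_uniq //.
by move=> [u r] [u' r'] /= _ _ [-> ->].
Qed.

Lemma discrete_arrivals t : discrete (arr t).
Proof.
move=> a; rewrite (arrivals_event1 t (fun=> a)) (arrivals_eventE _ (fun=> a));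
  apply: fin_bigcap_measurable => [|i _]; first exact: finite_seq.
exact: measurable_arrival.
Qed.

Definition arrival_law (k : nat) : R := fine (P (A (ord0, ord0) 0%N @^-1` [set k])).

Lemma arrivals_law t (a : state) :
  P [set w | arr t w = a] = (\prod_r arrival_law (a r))%:E.
Proof.
rewrite (arrivals_event1 t (fun=> a)) (probability_arrivals (fun=> a)) // big_seq1;
  congr EFin.
apply: eq_bigr => r _; congr fine.
exact: (A_ident (r, t) ((ord0, ord0), 0%N)).
Qed.

Lemma arrivals_past_indep t (a : nat -> state) :
  P ([set w | forall u, (u < t)%N -> arr u w = a u] `&` [set w | arr t w = a t]) =
  (P [set w | forall u, (u < t)%N -> arr u w = a u] * P [set w | arr t w = a t])%E.
Proof.
have e n : [set w | forall u, (u < n)%N -> arr u w = a u] =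
    [set w | forall u, u \in iota 0 n -> arr u w = a u].
  by apply/seteqP; split=> w h u; have := h u; rewrite mem_iota add0n.
have -> : [set w | forall u, (u < t)%N -> arr u w = a u] `&` [set w | arr t w = a t] =
    [set w | forall u, (u < t.+1)%N -> arr u w = a u].
  apply/seteqP; split=> [w [h1 h2] u|w h].
    by rewrite ltnS leq_eqVlt => /predU1P[->//|]; apply: h1.
  by split=> [u ut|]; apply: h => //; apply: ltnW.
rewrite arrivals_event1 !e !probability_arrivals ?iota_uniq // -EFinM; congr EFin.
by rewrite -addn1 iotaD big_cat.
Qed.

(** The arrivals of one slot are exchangeable; all the permutations that are
    needed are involutions. *)
Lemma permuted_arrivals_integral (sigma : queue -> queue) (f : state -> \bar R) :
  involutive sigma -> (forall x, 0 <= f x)%E ->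
  (\int[P]_w f [ffun r => arr 0 w (sigma r)] = \int[P]_w f (arr 0 w))%E.
Proof.
move=> sK f0.
have e a : [set w | [ffun r => arr 0 w (sigma r)] = a] =
    [set w | arr 0 w = [ffun r => a (sigma r)]].
  by apply/seteqP; split=> w /= /ffunP h; apply/ffunP => r; have := h (sigma r);
    rewrite !ffunE sK.
apply: (eq_law_integral (X := fun w => [ffun r => arr 0 w (sigma r)])) => //.
- by move=> a; rewrite e; apply: discrete_arrivals.
- exact: discrete_arrivals.
move=> a; rewrite e !arrivals_law; congr EFin.
rewrite (reindex_inj (inv_inj sK)); apply: eq_bigr => r _.
by rewrite ffunE sK.
Qed.

End Arrivals.

(** * Averaging over the arrivals of a slot *)

Section Averaging.
Context (d : measure_display) (T : measurableType d) (R : realType).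
Variables (P : probability T R) (A : queue -> nat -> {RV P >-> nat}) (lambda : R).
Hypothesis A_indep : mutually_independent (fun i : queue * nat => A i.1 i.2).
Hypothesis A_ident : identically_distributed (fun i : queue * nat => A i.1 i.2).
Hypothesis A_mean : forall r t, ('E_P[fun w => (A r t w)%:R] = lambda%:E)%E.
Implicit Types (V : nat -> nat -> nat -> nat -> R) (a x : state).

Notation arr := (arrivals A).

(** Only the mean of the arrivals is known to be finite, and a linear bound is
    what it takes to make the averages finite. *)
Definition linearly_bounded V : Prop := exists C : R, forall p p' o o',
  0 <= V p p' o o' <= C * (1 + (p + p' + o + o')%:R).

Definition add_loads V p p' o o' a : R :=
  V (p + (a q11 + a q12))%N (p' + (a q21 + a q22))%N
    (o + (a q11 + a q21))%N (o' + (a q12 + a q22))%N.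

Definition average V p p' o o' : R := \int[P]_w add_loads V p p' o o' (arr 0 w).

Lemma integral_affine_arrivals (c e : R) : 0 <= c -> 0 <= e ->
  (\int[P]_w (c + e * \sum_r (arr 0 w r)%:R)%:E = (c + e * (lambda *+ 4))%:E)%E.
Proof.
move=> c0 e0.
have mf (f : state -> \bar R) : measurable_fun setT (fun w => f (arr 0 w)).
  exact: (discrete_measurable_fun (discrete_arrivals A 0)).
rewrite (eq_integral (fun w => (c%:E + e%:E * (\sum_r ((arr 0 w r)%:R)%:E)))%E);
  last first.
  by move=> w _; rewrite sumEFin -EFinM -EFinD.
have s0 a : (0 <= \sum_(r : queue) ((a r)%:R)%:E :> \bar R)%E.
  by apply: sume_ge0 => r _; rewrite lee_fin ler0n.
rewrite ge0_integralD //; first last.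
- exact: (mf (fun a => e%:E * (\sum_r ((a r)%:R)%:E))%E).
- by move=> w _; rewrite mule_ge0.
rewrite ge0_integralZl //; last exact: (mf (fun a => (\sum_r ((a r)%:R)%:E))%E).
rewrite ge0_integral_sum //; last first.
  by move=> r; exact: (mf (fun a => ((a r)%:R)%:E)).
have -> : (\int[P]_w c%:E = c%:E)%E.
  apply: etrans (integral_cst P measurableT c%:E) _.
  by rewrite -[RHS]mule1; congr (_ * _)%E; apply: probability_setT.
rewrite (eq_bigr (fun=> lambda%:E)) => [|r _]; last first.
  rewrite -(A_mean r 0) expectation.unlock; apply: eq_integral => w _.
  by rewrite ffunE.
by rewrite sumEFin big_queue /= -EFinM -EFinD; congr EFin; ring.
Qed.

Lemma add_loads_bounded V p p' o o' C a :
  (forall p p' o o', 0 <= V p p' o o' <= C * (1 + (p + p' + o + o')%:R)) ->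
  0 <= add_loads V p p' o o' a <=
    C * (1 + (p + p' + o + o')%:R) + C *+ 2 * \sum_r (a r)%:R.
Proof.
move=> bV; have /andP[-> h] := bV (p + (a q11 + a q12))%N (p' + (a q21 + a q22))%N
    (o + (a q11 + a q21))%N (o' + (a q12 + a q22))%N.
apply: le_trans h _; rewrite big_queue /= !natrD le_eqVlt; apply/orP; left; apply/eqP;
  ring.
Qed.

Lemma bound_ge0 V C :
  (forall p p' o o', 0 <= V p p' o o' <= C * (1 + (p + p' + o + o')%:R)) -> 0 <= C.
Proof.
by move=> /(_ 0 0 0 0)%N /andP[h1 h2]; have := le_trans h1 h2; rewrite addr0 mulr1.
Qed.

Lemma integral_add_loads_le V p p' o o' C :
  (forall p p' o o', 0 <= V p p' o o' <= C * (1 + (p + p' + o + o')%:R)) ->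
  (\int[P]_w (add_loads V p p' o o' (arr 0 w))%:E <=
    (C * (1 + (p + p' + o + o')%:R) + C *+ 2 * (lambda *+ 4))%:E)%E.
Proof.
move=> bV; have C0 := bound_ge0 bV.
have mf (f : state -> \bar R) : measurable_fun setT (fun w => f (arr 0 w)).
  exact: (discrete_measurable_fun (discrete_arrivals A 0)).
rewrite -integral_affine_arrivals; first last.
- by rewrite mulrn_wge0.
- by rewrite mulr_ge0 // addr_ge0.
apply: ge0_le_integral => //.
- by move=> w _; rewrite lee_fin; case/andP: (add_loads_bounded p p' o o' (arr 0 w) bV).
- exact: (mf (fun a => (add_loads V p p' o o' a)%:E)).
- exact: (mf (fun a => (_ + _ * \sum_r (a r)%:R)%:E)).
by move=> w _; rewrite lee_fin; case/andP: (add_loads_bounded p p' o o' (arr 0 w) bV).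
Qed.

Lemma integrable_add_loads V p p' o o' : linearly_bounded V ->
  P.-integrable setT (EFin \o (fun w => add_loads V p p' o o' (arr 0 w))).
Proof.
move=> [C bV]; apply/integrableP; split.
  exact: (discrete_measurable_fun (discrete_arrivals A 0)
    (fun a => (add_loads V p p' o o' a)%:E)).
rewrite (eq_integral (fun w => (add_loads V p p' o o' (arr 0 w))%:E)).
  by apply: le_lt_trans (integral_add_loads_le p p' o o' bV) _; rewrite ltry.
move=> w _ /=; rewrite ger0_norm //.
by case/andP: (add_loads_bounded p p' o o' (arr 0 w) bV).
Qed.

Lemma averageE V p p' o o' : linearly_bounded V ->
  ((average V p p' o o')%:E = \int[P]_w (add_loads V p p' o o' (arr 0 w))%:E)%E.
Proof.
move=> bV; rewrite /average /Rintegral fineK //.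
by apply: integrable_fin_num => //; apply: integrable_add_loads.
Qed.

Lemma average_bounded V : linearly_bounded V -> linearly_bounded (average V).
Proof.
move=> bV; have [C hC] := bV; have C0 := bound_ge0 hC.
have l0 : 0 <= lambda.
  by rewrite -lee_fin -(A_mean q11 0) expectation.unlock integral_ge0.
exists (C + C *+ 2 * (lambda *+ 4)) => p p' o o'.
apply/andP; split.
  apply: Rintegral_ge0 => w _.
  by case/andP: (add_loads_bounded p p' o o' (arr 0 w) hC).
rewrite -lee_fin averageE //.
apply: le_trans (integral_add_loads_le p p' o o' hC) _; rewrite lee_fin.
rewrite [leRHS]mulrDl lerD2l ler_peMr //; last by rewrite lerDl.
by rewrite mulr_ge0 // mulrn_wge0.
Qed.

Lemma average_le2 V p1 p1' o1 o1' p2 p2' o2 o2' p3 p3' o3 o3' p4 p4' o4 o4' :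
  linearly_bounded V ->
  (forall a, add_loads V p1 p1' o1 o1' a + add_loads V p2 p2' o2 o2' a <=
             add_loads V p3 p3' o3 o3' a + add_loads V p4 p4' o4 o4' a) ->
  average V p1 p1' o1 o1' + average V p2 p2' o2 o2' <=
  average V p3 p3' o3 o3' + average V p4 p4' o4 o4'.
Proof.
move=> bV h; rewrite /average -!RintegralD //; try exact: integrable_add_loads.
by apply: le_Rintegral => //; exact: (integrableD measurableT
  (integrable_add_loads _ _ _ _ bV) (integrable_add_loads _ _ _ _ bV)).
Qed.

Let rev0 : rev_ord (ord0 : 'I_2) = ord_max. Proof. exact: val_inj. Qed.
Let rev1 : rev_ord (ord_max : 'I_2) = ord0. Proof. exact: val_inj. Qed.

Lemma average_permuted V (sigma : queue -> queue) p p' o o' q q' u u' :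
  linearly_bounded V -> involutive sigma ->
  (forall a, add_loads V p p' o o' [ffun r => a (sigma r)] = add_loads V q q' u u' a) ->
  average V p p' o o' = average V q q' u u'.
Proof.
move=> [C bV] sK h; rewrite /average /Rintegral; congr fine.
rewrite -(permuted_arrivals_integral A_indep A_ident
  (f := fun a => (add_loads V p p' o o' a)%:E) sK).
  by apply: eq_integral => w _; rewrite h.
by move=> a; rewrite lee_fin; case/andP: (add_loads_bounded p p' o o' a bV).
Qed.

(** The inequalities hold pointwise after the arrivals are added, and the
    symmetries hold because the arrivals are exchangeable. *)
Lemma average_structured V :
  linearly_bounded V -> structured V -> structured (average V).
Proof.
move=> bV sV; split.
- split=> p p' o o'.
  + apply: (@average_permuted _ (fun r => (rev_ord r.1, r.2))) => // [[i j]|a].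
      by rewrite /= rev_ordK.
    rewrite /add_loads !ffunE /= !(rev0, rev1) (swap_inputs sV).
    by rewrite (addnC (a q21) (a q11)) (addnC (a q22) (a q12)).
  + apply: (@average_permuted _ (fun r => (r.1, rev_ord r.2))) => // [[i j]|a].
      by rewrite /= rev_ordK.
    rewrite /add_loads !ffunE /= !(rev0, rev1) (swap_outputs sV).
    by rewrite (addnC (a q12) (a q11)) (addnC (a q22) (a q21)).
  + apply: (@average_permuted _ (fun r => (r.2, r.1))) => // [[i j]|a] //.
    by rewrite /add_loads !ffunE /= (transpose sV).
- move=> p p' o o' h; rewrite -(lerD2r (average V 0 0 0 0)).
  apply: average_le2 => // a; rewrite lerD2r /add_loads !addSn.
  by apply: monotone11 => //; lia.
- move=> p p' o o' h; apply: average_le2 => // a; rewrite /add_loads !addSn.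
  by apply: supermodular => //; lia.
- move=> p p' o o' h; apply: average_le2 => // a; rewrite /add_loads !addSn.
  by apply: superconvex => //; lia.
- move=> p p' o o' h; apply: average_le2 => // a; rewrite /add_loads !addSn.
  by apply: submodular => //; lia.
Qed.

Lemma average_next V t x : linearly_bounded V ->
  ((state_loads (average V) x)%:E =
   \int[P]_w (state_loads V [ffun r => (x r + arr t w r)%N])%:E)%E.
Proof.
move=> bV; have [C hC] := bV; rewrite /state_loads /loads_of averageE //.
rewrite -(@eq_law_integral _ _ _ P _ (arr t) (arr 0) (fun a => (add_loads V
  (x q11 + x q12) (x q21 + x q22) (x q11 + x q21) (x q12 + x q22) a)%:E)) //.
- apply: eq_integral => w _; rewrite /add_loads !ffunE /=.
  by congr (V _ _ _ _)%:E; rewrite addnACA.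
- exact: discrete_arrivals.
- exact: discrete_arrivals.
- by move=> a; rewrite lee_fin; case/andP: (add_loads_bounded (x q11 + x q12)
    (x q21 + x q22) (x q11 + x q21) (x q12 + x q22) a hC).
- by move=> a; rewrite !(arrivals_law A_indep A_ident).
Qed.

End Averaging.

(** * Histories of a policy *)

Section Histories.
Context (d : measure_display) (T : measurableType d) (R : realType).
Variables (P : probability T R) (A : queue -> nat -> {RV P >-> nat}).
Variable q : state.

Notation arr := (arrivals A).
Notation event := (state * schedule)%type.

Fixpoint run (g : nat -> event) (t : nat) : state :=
  if t is u.+1 then next_state (run g u) (g u).2 (g u).1 else q.

Lemma eq_run g g' t : (forall u, (u < t)%N -> g u = g' u) -> run g t = run g' t.
Proof.
elim: t => //= t IH h; rewrite h // IH // => u ut.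
by apply: h; apply: ltnW.
Qed.

Lemma queue_lengthE S t w :
  queue_length A q S t w = run (fun u => (arr u w, S u w)) t.
Proof. by elim: t => //= t ->. Qed.

(** Turns a finite history into a sequence, with [x] for all the slots from [t]
    on. *)
Definition extend t (h : {ffun 'I_t -> event}) (x : event) (u : nat) : event :=
  oapp h x (insub u).

Variable S : nat -> T -> schedule.
Hypothesis S_policy : is_policy A S.

Definition history t w : {ffun 'I_t -> event} := [ffun i : 'I_t => (arr i w, S i w)].

Lemma history_eq t h x w :
  history t w = h <-> forall u, (u < t)%N -> (arr u w, S u w) = extend h x u.
Proof.
split=> [<- u ut|e]; first by rewrite /extend insubT /= ffunE.
by apply/ffunP => i; rewrite ffunE e // /extend valK.
Qed.

Lemma history_past t h x : [set w | history t w = h] =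
  past A S t (fun u => (extend h x u).1) (fun u => (extend h x u).2).
Proof.
apply/seteqP; split=> w /=.
  by move=> /(history_eq h x) e u ut; rewrite -e.
move=> e; apply/(history_eq h x) => u ut.
by have [-> ->] := e u ut; case: extend.
Qed.

Lemma measurable_past t a s : measurable (past A S t a s).
Proof.
have -> : past A S t a s = \bigcap_(u in [set u | (u < t)%N])
    ([set w | arr u w = a u] `&` [set w | S u w = s u]) by [].
apply: bigcap_measurableType => u _; apply: measurableI.
  exact: discrete_arrivals.
by case: S_policy.
Qed.

Definition full_history t w := (history t w, S t w).

Lemma full_historyE t h s : [set w | full_history t w = (h, s)] =
  [set w | history t w = h] `&` [set w | S t w = s].
Proof. by apply/seteqP; split=> w; rewrite /full_history /= => -[-> ->]. Qed.

Lemma discrete_history t : discrete (history t).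
Proof.
move=> h; rewrite (history_past h ([ffun=> 0%N], single (ord0, ord0))).
exact: measurable_past.
Qed.

Lemma discrete_full_history t : discrete (full_history t).
Proof.
move=> [h s]; rewrite full_historyE; apply: measurableI.
  exact: discrete_history.
by case: S_policy.
Qed.

(** The atoms of the definition of a policy are those of the history up to slot
    [t], including the schedule of that slot. *)
Lemma full_history_indep t hs a :
  (P ([set w | full_history t w = hs] `&` [set w | arr t w = a]) =
  P [set w | full_history t w = hs] * P [set w | arr t w = a])%E.
Proof.
case: hs => h s; rewrite full_historyE (history_past h (a, s)).
have [_ /(_ t (fun u => (extend h (a, s) u).1) (fun u => (extend h (a, s) u).2))] := S_policy.
by rewrite [extend _ _ t]/extend insubN ?ltnn.
Qed.

Lemma queue_length_history t w x :
  queue_length A q S t w = run (extend (history t w) x) t.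
Proof.
rewrite queue_lengthE; apply: eq_run => u ut.
by have /(history_eq _ x) -> := erefl (history t w).
Qed.

Lemma measurable_queue_length (f : state -> schedule -> \bar R) t :
  measurable_fun setT (fun w => f (queue_length A q S t w) (S t w)).
Proof.
pose x : event := ([ffun=> 0%N], single (ord0, ord0)).
have := discrete_measurable_fun (@discrete_full_history t)
  (fun hs : {ffun 'I_t -> event} * schedule => f (run (extend hs.1 x) t) hs.2)
    (D := setT).
by apply: eq_measurable_fun => w _; rewrite -queue_length_history.
Qed.

(** The queue lengths and the schedule of slot [t] are functions of the history,
    which is independent of the arrivals of that slot. *)
Lemma integral_next_state (f : state -> \bar R) t : (forall x, 0 <= f x)%E ->
  (\int[P]_w f (queue_length A q S t.+1 w) =
   \int[P]_w \int[P]_w' f (next_state (queue_length A q S t w) (S t w) (arr t w')))%E.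
Proof.
move=> f0; pose x : event := ([ffun=> 0%N], single (ord0, ord0)).
have := @integral_indep _ _ _ P _ _ (full_history t) (arr t)
  (@discrete_full_history t) (discrete_arrivals A t) (@full_history_indep t)
  (fun (hs : {ffun 'I_t -> event} * schedule) a => f (next_state (run (extend hs.1 x) t) hs.2 a)).
move=> /(_ ltac:(by [])) e.
under eq_integral do rewrite /= (queue_length_history _ _ x).
rewrite e; apply: eq_integral => w _.
by under [RHS]eq_integral do rewrite (queue_length_history _ _ x).
Qed.

End Histories.

(** * Value iteration *)

Section Values.
Context (d : measure_display) (T : measurableType d) (R : realType).
Variables (P : probability T R) (A : queue -> nat -> {RV P >-> nat}) (lambda : R).
Hypothesis A_indep : mutually_independent (fun i : queue * nat => A i.1 i.2).
Hypothesis A_ident : identically_distributed (fun i : queue * nat => A i.1 i.2).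
Hypothesis A_mean : forall r t, ('E_P[fun w => (A r t w)%:R] = lambda%:E)%E.
Variable beta : R.
Hypothesis beta_ge0 : 0 <= beta.

Notation arr := (arrivals A).

(** The cost of Algorithm 1 over [n] slots, as a function of the port loads. *)
Fixpoint value (n : nat) : nat -> nat -> nat -> nat -> R :=
  if n is m.+1 then bellman beta (average A (value m)) else fun _ _ _ _ => 0.

Lemma bellman_bounded (W : nat -> nat -> nat -> nat -> R) : linearly_bounded W ->
  linearly_bounded (bellman beta W).
Proof.
move=> [C hC]; have C0 := bound_ge0 hC; exists (1 + beta * C) => p p' o o'.
have /andP[s0 s1] : 0 <= serve W p p' o o' <= C * (1 + (p + p' + o + o')%:R).
  have /andP[-> h] := hC (maxn p p').-1
    (minn p p' - ((0 < minn p p')%N && (0 < minn o o')%N))%N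
    (maxn o o').-1 (minn o o' - ((0 < minn p p')%N && (0 < minn o o')%N))%N.
  by apply: le_trans h _; rewrite ler_wpM2l // lerD2l ler_nat; lia.
have n0 : 0 <= (p + p' + o + o')%:R :> R by [].
rewrite /bellman; apply/andP; split; first by rewrite addr_ge0 // ?divr_ge0 // mulr_ge0.
have := ler_wpM2l beta_ge0 s1; rewrite mulrDl mul1r -mulrA; lra.
Qed.

Lemma value_good n : structured (value n) /\ linearly_bounded (value n).
Proof.
elim: n => [|n [sV bV]] /=.
  split; last by exists 0 => *; rewrite mul0r lexx.
  by split=> [|*|*|*|*]; rewrite ?addr0.
split; first exact: bellman_structured beta_ge0
  (average_structured A_indep A_ident A_mean bV sV).
exact: bellman_bounded (average_bounded A_mean bV).
Qed.

Lemma value_ge0 n p p' o o' : 0 <= value n p p' o o'.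
Proof. by have [_ [C /(_ p p' o o') /andP[]]] := value_good n. Qed.

Lemma average_value_ge0 n p p' o o' : 0 <= average A (value n) p p' o o'.
Proof.
have [_ bV] := value_good n.
by have [C /(_ p p' o o') /andP[]] := average_bounded A_mean bV.
Qed.

Lemma cost_ge0 (x : state) : 0 <= cost (fun=> 1 : R) x.
Proof. by apply: sumr_ge0 => r _; rewrite mul1r. Qed.

Lemma valueS n (x : state) : state_loads (value n.+1) x =
  cost (fun=> 1) x + beta * state_loads (serve (average A (value n))) x.
Proof.
rewrite /state_loads /loads_of /cost /= /bellman; congr (_ + _).
by rewrite big_queue /= !natrD; field.
Qed.

Section Policy.
Variables (q : state) (S : nat -> T -> schedule).
Hypothesis S_policy : is_policy A S.
Notation Q := (queue_length A q S).

Let mQ (f : state -> \bar R) t : measurable_fun setT (fun w => f (Q t w)).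
Proof. exact: (measurable_queue_length q S_policy (fun x _ => f x)). Qed.

Lemma integral_value_next n t :
  (\int[P]_w (state_loads (value n) (Q t.+1 w))%:E =
   \int[P]_w (state_loads (average A (value n)) (unserved (Q t w) (S t w)))%:E)%E.
Proof.
have [_ bV] := value_good n.
rewrite (integral_next_state q S_policy (f := fun x => (state_loads (value n) x)%:E)).
  apply: eq_integral => w _; rewrite (average_next A_indep A_ident A_mean t) //.
  apply: eq_integral => w' _; congr (state_loads _ _)%:E.
  by apply/ffunP => r; rewrite !ffunE.
by move=> x; rewrite lee_fin value_ge0.
Qed.

Lemma integral_valueS n t :
  (\int[P]_w (state_loads (value n.+1) (Q t w))%:E =
   \int[P]_w (cost (fun=> 1) (Q t w))%:E +
   beta%:E * \int[P]_w (state_loads (serve (average A (value n))) (Q t w))%:E)%E.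
Proof.
rewrite -ge0_integralZl //; first last.
- by move=> w _; rewrite lee_fin average_value_ge0.
- exact: (mQ (fun x => (state_loads (serve (average A (value n))) x)%:E)).
rewrite -ge0_integralD //; first last.
- exact: (mQ (fun x => beta%:E * (state_loads (serve (average A (value n))) x)%:E)%E).
- by move=> w _; rewrite -EFinM lee_fin mulr_ge0 // average_value_ge0.
- exact: (mQ (fun x => (cost (fun=> 1) x)%:E)).
- by move=> w _; rewrite lee_fin cost_ge0.
by apply: eq_integral => w _; rewrite valueS EFinD EFinM.
Qed.

(** Bellman's inequality: no schedule does better than [serve]. *)
Lemma value_le_step n t :
  (\int[P]_w (state_loads (value n.+1) (Q t w))%:E <=
   \int[P]_w (cost (fun=> 1) (Q t w))%:E +
   beta%:E * \int[P]_w (state_loads (value n) (Q t.+1 w))%:E)%E.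
Proof.
rewrite integral_valueS integral_value_next; apply: leeD2l.
apply: lee_wpmul2l => //; have [sV bV] := value_good n.
apply: ge0_le_integral => //.
- by move=> w _; rewrite lee_fin average_value_ge0.
- exact: (mQ (fun x => (state_loads (serve (average A (value n))) x)%:E)).
- exact: (measurable_queue_length q S_policy
    (fun x s => (state_loads (average A (value n)) (unserved x s))%:E)).
by move=> w _; rewrite lee_fin serve_le //;
  exact (average_structured A_indep A_ident A_mean bV sV).
Qed.

Lemma value_eq_step n t :
  {ae P, forall w, algorithm1_choice (Q t w) (S t w)} ->
  (\int[P]_w (state_loads (value n.+1) (Q t w))%:E =
   \int[P]_w (cost (fun=> 1) (Q t w))%:E +
   beta%:E * \int[P]_w (state_loads (value n) (Q t.+1 w))%:E)%E.
Proof.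
move=> S_alg; rewrite integral_valueS integral_value_next; congr (_ + _ * _)%E.
have [sV bV] := value_good n.
apply: ge0_ae_eq_integral => //.
- exact: (mQ (fun x => (state_loads (serve (average A (value n))) x)%:E)).
- exact: (measurable_queue_length q S_policy
    (fun x s => (state_loads (average A (value n)) (unserved x s))%:E)).
- by move=> w _; rewrite lee_fin average_value_ge0.
- by move=> w _; rewrite lee_fin average_value_ge0.
apply: filterS S_alg => w aw _; rewrite serve_algorithm1 //.
exact (average_structured A_indep A_ident A_mean bV sV).
Qed.

Definition partial_cost t n : \bar R :=
  (\sum_(k < n) (beta ^+ k)%:E * \int[P]_w (cost (fun=> 1) (Q (t + k) w))%:E)%E.

Lemma partial_costS t n : (partial_cost t n.+1 =
  \int[P]_w (cost (fun=> 1%R) (Q t w))%:E + beta%:E * partial_cost t.+1 n)%E.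
Proof.
have c0 k : (0 <= \int[P]_w (cost (fun=> 1%R) (Q k w))%:E)%E.
  by apply: integral_ge0 => w _; rewrite lee_fin cost_ge0.
rewrite /partial_cost big_ord_recl expr0 mul1e addn0; congr (_ + _)%E.
rewrite ge0_sume_distrr; last first.
  by move=> k _; rewrite mule_ge0 // lee_fin exprn_ge0.
by apply: eq_bigr => k _; rewrite exprS EFinM muleA addSnnS.
Qed.

Lemma value_le_partial_cost t n :
  (\int[P]_w (state_loads (value n) (Q t w))%:E <= partial_cost t n)%E.
Proof.
elim: n t => [|n IH] t.
  by rewrite /partial_cost big_ord0 integral0_eq.
rewrite partial_costS; apply: le_trans (value_le_step n t) _.
by apply: leeD2l; apply: lee_wpmul2l.
Qed.

Lemma value_eq_partial_cost t n :
  (forall t, {ae P, forall w, algorithm1_choice (Q t w) (S t w)}) ->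
  (\int[P]_w (state_loads (value n) (Q t w))%:E = partial_cost t n)%E.
Proof.
move=> S_alg; elim: n t => [|n IH] t.
  by rewrite /partial_cost big_ord0 integral0_eq.
by rewrite partial_costS value_eq_step // IH.
Qed.

Lemma discounted_costE : discounted_cost A (fun=> 1) beta q S =
  limn (fun n => partial_cost 0 n).
Proof.
rewrite /discounted_cost; congr (limn _); apply/funext => n.
rewrite big_mkord; apply: eq_bigr => k _; rewrite expectation.unlock add0n.
rewrite -ge0_integralZl ?lee_fin ?exprn_ge0 //.
- exact: (mQ (fun x => (cost (fun=> 1) x)%:E)).
- by move=> w _; rewrite lee_fin cost_ge0.
Qed.

Lemma partial_cost_cvg : cvgn (fun n => partial_cost 0 n).
Proof.
apply: ereal_nondecreasing_is_cvgn => m n mn; rewrite /partial_cost.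
apply: (lee_sum_nneg_ord
  (fun k => (beta ^+ k)%:E * \int[P]_w (cost (fun=> 1%R) (Q (0 + k) w))%:E)%E xpredT) => // k _.
by rewrite mule_ge0 ?lee_fin ?exprn_ge0 // integral_ge0 // => w _;
  rewrite lee_fin cost_ge0.
Qed.

End Policy.

(** Over every finite horizon [n], Algorithm 1 costs [value n] at the initial
    state, and no policy, even one that depends on the history, costs less. *)
Lemma discounted_cost_le q S S' : follows_algorithm1 A q S -> is_policy A S' ->
  (discounted_cost A (fun=> 1%R) beta q S <= discounted_cost A (fun=> 1%R) beta q S')%E.
Proof.
move=> [S_policy S_alg] S'_policy; rewrite !discounted_costE //.
apply: lee_lim; [exact: partial_cost_cvg|exact: partial_cost_cvg|].
apply: nearW => n; rewrite -(value_eq_partial_cost S_policy 0 n S_alg).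
exact: (value_le_partial_cost q S'_policy 0 n).
Qed.

End Values.

(** * Stationary deterministic policies *)

Section FeedbackPolicies.
Context (d : measure_display) (T : measurableType d) (R : realType).
Variables (P : probability T R) (A : queue -> nat -> {RV P >-> nat}).
Hypothesis A_indep : mutually_independent (fun i : queue * nat => A i.1 i.2).
Variables (q : state) (f : state -> schedule).

Notation arr := (arrivals A).

(** The queue lengths under the policy that uses [f x] in state [x], for a given
    sequence of arrivals. *)
Fixpoint feedback_queue (a : nat -> state) (t : nat) : state :=
  if t is u.+1
  then next_state (feedback_queue a u) (f (feedback_queue a u)) (a u) else q.

Lemma eq_feedback_queue a a' t : (forall u, (u < t)%N -> a u = a' u) ->
  feedback_queue a t = feedback_queue a' t.
Proof.
elim: t => //= t IH h; rewrite h // IH // => u ut.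
by apply: h; apply: ltnW.
Qed.

Definition feedback (t : nat) (w : T) : schedule := f (feedback_queue (arr ^~ w) t).

Lemma queue_length_feedback t w :
  queue_length A q feedback t w = feedback_queue (arr ^~ w) t.
Proof. by elim: t => //= t ->. Qed.

Lemma discrete_feedback_queue t : discrete (fun w => feedback_queue (arr ^~ w) t).
Proof.
elim: t => [|t IH] x /=.
  have [->|qx] := eqVneq q x.
    by rewrite (_ : [set _ | _] = setT) //; apply/seteqP; split.
  rewrite (_ : [set _ | _] = set0) //; apply/seteqP; split=> w //= e.
  by rewrite e eqxx in qx.
exact: (discrete_preimage (discrete_pair IH (discrete_arrivals A t))
  [set xa : state * state | next_state xa.1 (f xa.1) xa.2 = x]).
Qed.

(** The schedules are determined by the arrivals, so a prescribed sequence of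
    schedules either is the one that the prescribed arrivals produce, or
    contradicts it. *)
Lemma past_feedback t a s :
  past A feedback t a s `&` [set w | feedback t w = s t] =
    [set w | forall u, (u < t)%N -> arr u w = a u] \/
  past A feedback t a s `&` [set w | feedback t w = s t] = set0.
Proof.
have eqa w u : (u <= t)%N -> (forall u, (u < t)%N -> arr u w = a u) ->
    feedback u w = f (feedback_queue a u).
  move=> ut h; congr f; apply: eq_feedback_queue => v vu.
  by apply: h; apply: leq_trans ut.
have [fs|nfs] := pselect (forall u, (u <= t)%N -> f (feedback_queue a u) = s u).
  left; apply/seteqP; split=> w /= => [[h _] u ut|h]; first by case: (h u ut).
  split=> [u ut|]; last by rewrite (eqa w t) // fs.
  by rewrite (eqa w u (ltnW ut)) // fs 1?ltnW // h.
right; apply/seteqP; split=> w //= -[h1 h2].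
apply: nfs => u ut; rewrite -(eqa w) //; last by move=> v /h1[].
by move: ut; rewrite leq_eqVlt => /predU1P[->//|/h1[]].
Qed.

Lemma feedback_policy : is_policy A feedback.
Proof.
split=> [t s|t a s].
  exact: (discrete_preimage (@discrete_feedback_queue t) [set x | f x = s]).
have [->|->] := past_feedback t a s; first exact: arrivals_past_indep.
by rewrite set0I measure0 mul0e.
Qed.

Lemma feedback_stationary : stationary_markov A q feedback.
Proof.
split; first exact: feedback_policy.
exists (fun x s => (s == f x)%:R); split.
- by move=> x s.
- move=> x; rewrite (bigD1 (f x)) //= eqxx big1 ?addr0 // => s /negPf->.
  by [].
move=> t a s x s0; have [->|ns] := eqVneq s0 (f x).
  rewrite mul1e; congr (P _); apply/seteqP; split=> w /=; first by case.
  by move=> [h e]; split => //; rewrite /feedback -queue_length_feedback e.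
rewrite mul0e (_ : _ `&` _ = set0) ?measure0 //; apply/seteqP; split=> w //=.
move=> [[_ e] fw]; move: ns; rewrite -fw /feedback -queue_length_feedback e.
by rewrite eqxx.
Qed.

Lemma feedback_algorithm1 : (forall x, algorithm1_choice x (f x)) ->
  follows_algorithm1 A q feedback.
Proof.
move=> f_alg; split; first exact: feedback_policy.
by move=> t; apply: aeW => w; rewrite queue_length_feedback; apply: f_alg.
Qed.

End FeedbackPolicies.

(** * Optimality of Algorithm 1 *)

Theorem theorem5 (d : measure_display) (T : measurableType d) (R : realType)
    (P : probability T R) (A : queue -> nat -> {RV P >-> nat}) (lambda : R)
    (A_indep : mutually_independent (fun i : queue * nat => A i.1 i.2))
    (A_ident : identically_distributed (fun i : queue * nat => A i.1 i.2))
    (A_mean : forall r t, ('E_P[fun w => (A r t w)%:R] = lambda%:E)%E)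
    (lambda_lt : lambda < 2^-1)
    (beta : R) (beta_gt0 : 0 < beta) (beta_lt1 : beta < 1)
    (q : state) (S : nat -> T -> schedule)
    (S_alg : follows_algorithm1 A q S) :
  is_minimum
    [set discounted_cost A (fun=> 1) beta q S' | S' in stationary_markov A q]
    (discounted_cost A (fun=> 1) beta q S).
Proof.
have cost_le := discounted_cost_le A_indep A_ident A_mean (ltW beta_gt0).
have [f f_alg] := choice algorithm1_choice_exists.
split; last by move=> _ [S' [S'_policy _] <-]; apply: cost_le.
exists (feedback A q f); first exact: feedback_stationary.
apply/eqP; rewrite eq_le; apply/andP; split; apply: cost_le => //.
- exact: feedback_algorithm1.
- by case: S_alg.
exact: feedback_policy.
Qed.
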